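(* Let $p_1,\dots,p_r$ be distinct primes and let $G=G_1\times G_2\times\cdots\times G_r$ be a finite abelian group, where for each $1\le i\le r$ we have $G_i\cong \mathbb{Z}_{p_i^{i_1}}\times\mathbb{Z}_{p_i^{i_2}}\times\cdots\times\mathbb{Z}_{p_i^{i_{n_i}}}$ with $n_i\ge 1$ and positive integer exponents $i_1,i_2,\dots,i_{n_i}$. Let $\deg(x)$ denote the degree of the vertex $x\in G$ in the Co-Prime Order graph $\Theta(G)$. Then: (i) If $o(x)=1$ or $o(x)=p_i$ for some $i\in\{1,\dots,r\}$, then $$\deg(x)=\prod_{k=1}^{r}p_k^{\sum_{j=1}^{n_k}k_j}-1 .$$ (ii) Suppose $o(x)=\Big(\prod_{i=1}^{k}p_{\alpha_i}\Big)\Big(\prod_{i=1}^{l}p_{\beta_i}^{\gamma_i}\Big)$, where $k,l\ge 0$ are integers, $p_{\alpha_1},\dots,p_{\alpha_k},p_{\beta_1},\dots,p_{\beta_l}$ are distinct primes from the set $\{p_1,\dots,p_r\}$, $\gamma_1,\dots,\gamma_l\ge 2$, and ($2\le k+l\le r$ or $l\ge 1$). Then $$\deg(x)=\Big(-k-l+1+\sum_{j=1}^{k}|G_{\alpha_j}|+\sum_{j=1}^{l}(p_{\beta_j})^{n_{\beta_j}}\Big)\,\frac{|G|}{\Big(\prod_{i=1}^{k}|G_{\alpha_i}|\Big)\Big(\prod_{i=1}^{l}|G_{\beta_i}|\Big)} .$$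
   Context: For a finite group $G$, $o(x)$ denotes the order of $x\in G$. The Co-Prime Order graph $\Theta(G)$ is the simple undirected graph with vertex set $G$ in which two distinct vertices $x,y$ are adjacent if and only if $\gcd(o(x),o(y))$ is $1$ or a prime. $\mathbb{Z}_m$ is the cyclic group of order $m$. In the notation $i_1,\dots,i_{n_i}$, the symbol $i_j$ is the $j$-th exponent attached to the prime $p_i$ (so $k_j$ is the $j$-th exponent attached to $p_k$), and $n_i$ is the number of cyclic factors of $G_i$. The indices $\alpha_i,\beta_i$ are elements of $\{1,\dots,r\}$, and $G_{\alpha_i}$, $G_{\beta_i}$, $n_{\beta_i}$ are the factors and numbers of cyclic factors for those indices. Empty sums are $0$ and empty products are $1$. *)

(* Defs.v *)
From mathcomp Require Import all_boot all_order all_algebra all_fingroup.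

Set Implicit Arguments.
Unset Strict Implicit.
Unset Printing Implicit Defensive.

Import GroupScope.

(* The subgroup G is the vertex set: elements of gT outside G are
   isolated, and hence do not contribute to any degree. *)
Definition coprime_order_graph (gT : finGroupType) (G : {group gT}) : rel gT :=
  fun x y =>
    [&& x \in G, y \in G, x != y &
        let d := gcdn #[x] #[y] in (d == 1%N) || prime d].

Lemma coprime_order_graph_sym (gT : finGroupType) (G : {group gT}) :
  symmetric (coprime_order_graph G).
Proof.
move=> x y; rewrite /coprime_order_graph gcdnC eq_sym.
by case: (x \in G); case: (y \in G).
Qed.

Lemma coprime_order_graph_irr (gT : finGroupType) (G : {group gT}) :
  irreflexive (coprime_order_graph G).
Proof. by move=> x; rewrite /coprime_order_graph eqxx !andbF. Qed.

Definition degree (T : finType) (adj : rel T) (x : T) : nat :=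
  #|[set y | adj x y]|.

(* Z_{p^{e_0}} x ... x Z_{p^{e_{m-1}}}. Since 'Z_q is Z/qZ only for q > 1,
   this reading requires p > 1 and e_j > 0 for all j. *)
Definition prod_cyclic (p m : nat) (e : 'I_m -> nat) : finGroupType :=
  {dffun forall j : 'I_m, 'Z_(p ^ e j)}.

(* Main.v *)
Require Import Defs.
From mathcomp Require Import all_boot all_order all_algebra all_fingroup all_solvable.
From mathcomp Require Import ring.

Set Implicit Arguments.
Unset Strict Implicit.
Unset Printing Implicit Defensive.

(** Write N for the order of x and B for the subgroup of those y in G whose
order is coprime to N; since G is abelian, B is the Hall subgroup
'O_\pi(N)^'(G).

If N is 1 or a prime, then gcd(N, #[y]) always divides a prime, so x is
joined to every other element.

Otherwise x fails the condition on gcd(N, #[y]) at y = x, because gcd(N, N) = N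
is neither 1 nor prime, and the neighbours of x are sorted by the value of
gcd(N, #[y]), which is 1 or a prime divisor q of N. The value 1 accounts for
B. For a prime q dividing N, the condition that gcd(N, #[y]) divides q can be
checked one primary component at a time: the components of y at the other
prime divisors of N must be trivial, those at primes not dividing N are free, and
the q-component is free if q divides N exactly once, but must be killed by q
if q ^ 2 divides N. Hence these y form a product A * B
(gcd_order_dvd_prime), where A is either the Sylow q-subgroup or its
subgroup of elements killed by q, and A and B have coprime orders. Removing
the y with gcd equal to 1 leaves |B| (|A| - 1) elements, and summing gives
degree_composite_order:

  deg x = |B| (1 + sum over the primes q dividing N of (|A_q| - 1)).

It remains to put the given decomposition into this formula. Each G_i is the
Sylow p_i-subgroup of G (Sylow_bigdprod), so |B| is |G| divided by the orders
of the G_i with p_i dividing N; and in a product of n nontrivial cyclic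
p-groups exactly p ^ n elements are killed by p (card_Ldiv_prod_cyclic). *)

Import GroupScope.
Local Open Scope nat_scope.

(** * Counting and prime factorisations *)

Lemma card_fiber_seq (T : finType) (V : eqType) (D : {set T}) (f : T -> V)
    (s : seq V) :
  uniq s ->
  #|[set y in D | f y \in s]| = (\sum_(v <- s) #|[set y in D | f y == v]|)%N.
Proof.
elim: s => [|v s IHs] /=.
  by rewrite big_nil eq_card0 // => y; rewrite !inE andbF.
move=> /andP[vs us]; rewrite big_cons -IHs // -cardsUI [X in (_ + X)%N]eq_card0.
  by rewrite addn0; apply: eq_card => y; rewrite !inE -andb_orr.
by move=> y; rewrite !inE; case: eqP => [->|]; rewrite ?andbF // (negPf vs) !andbF.
Qed.

Lemma partn_primes_prod (m N : nat) :
  0 < m -> (m`_\pi(N) = \prod_(q <- primes N) m`_q)%N.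
Proof.
move=> m_gt0.
(* The range of the product defining the part of m is widened up to m + N, so
   that it contains every prime divisor of N. *)
rewrite (@widen_partn (m + N)%N) ?leq_addr // -big_filter.
under [RHS]eq_bigr => q _ do rewrite p_part.
apply: perm_big; apply: uniq_perm.
- exact: filter_uniq (iota_uniq _ _).
- exact: primes_uniq.
move=> q; rewrite mem_filter mem_index_iota /= ltnS.
rewrite /in_mem /=; case qN: (q \in primes N) => //=.
move: (qN); rewrite mem_primes => /and3P[_ N_gt0 qdN].
by rewrite (leq_trans (dvdn_leq N_gt0 qdN)) ?leq_addl.
Qed.

Section PrimePowers.

Variables (I : finType) (q c : I -> nat).
Hypotheses (q_pr : forall i, prime (q i)) (q_inj : injective q).

Lemma logn_prod_prime_powers i : logn (q i) (\prod_j q j ^ c j)%N = c i.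
Proof.
rewrite (bigD1 i) //= mulnC logn_Gauss ?pfactorK //.
rewrite prime_coprime // Euclid_dvd_prod // big_orE; apply/exists_inP => -[j ji].
rewrite Euclid_dvdX // dvdn_prime2 // (inj_eq q_inj) => /andP[/eqP ij _].
by rewrite ij eqxx in ji.
Qed.

Lemma perm_primes_prod_prime_powers :
  (forall i, 0 < c i) -> perm_eq (primes (\prod_j q j ^ c j)%N) (map q (enum I)).
Proof.
move=> c_gt0; apply: uniq_perm; first exact: primes_uniq.
  by rewrite map_inj_uniq ?enum_uniq.
move=> s; have N_gt0 : (0 < \prod_j q j ^ c j)%N.
  by rewrite prodn_gt0 // => j; rewrite expn_gt0 prime_gt0.
rewrite mem_primes N_gt0 /=; apply/andP/mapP => [[s_pr]|[i _ ->]]; last first.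
  by split=> //; rewrite (bigD1 i) //= dvdn_mulr // dvdn_exp.
rewrite Euclid_dvd_prod // big_orE => /exists_inP[i _].
rewrite Euclid_dvdX // dvdn_prime2 // => /andP[/eqP-> _].
by exists i; rewrite ?mem_enum.
Qed.
End PrimePowers.

Lemma logn_le1_of_prime_or1 m s : (m == 1) || prime m -> logn s m <= 1.
Proof.
case/orP=> [/eqP->|m_pr]; first by rewrite logn1.
by rewrite logn_prime // leq_b1.
Qed.

Lemma size_primes_le1_of_prime_or1 m : (m == 1) || prime m -> size (primes m) <= 1.
Proof. by case/orP=> [/eqP->|m_pr] //; rewrite primes_prime. Qed.

(** * Degrees in the co-prime order graph of an abelian group *)

Section Degree.
Variables (gT : finGroupType) (G : {group gT}) (x : gT).
Hypothesis xG : x \in G.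

Lemma degree_order1_or_prime :
  (#[x] == 1) || prime #[x] -> degree (coprime_order_graph G) x = #|G|.-1.
Proof.
move=> x_pr; rewrite [in RHS](cardsD1 x G) xG /=; apply: eq_card => y.
rewrite !inE /coprime_order_graph xG /= eq_sym; case: (y \in G); rewrite ?andbF ?andbT //=.
suff ->: (gcdn #[x] #[y] == 1) || prime (gcdn #[x] #[y]) by rewrite andbT.
have [/eqP->|x_p] := orP x_pr; first by rewrite gcd1n.
have [_ x_dv] := primeP x_p.
by have /pred2P[->|->] := x_dv _ (dvdn_gcdl #[x] #[y]); rewrite ?x_p ?orbT.
Qed.

Hypothesis abelG : abelian G.

(** For a prime q dividing #[x], the possible q-components of the y such that
gcdn #[x] #[y] divides q. *)
Definition local_nbr (q : nat) : {set gT} :=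
  if q ^ 2 %| #[x] then 'Ldiv_q(G) else 'O_q(G).

Lemma local_nbr_group_set q : group_set (local_nbr q).
Proof. by rewrite /local_nbr; case: ifP => _; [apply: group_Ldiv | apply: groupP]. Qed.
Canonical local_nbr_group q := Group (local_nbr_group_set q).

Lemma mem_abelian_pcore (pi : nat_pred) y : y \in G -> (y \in 'O_pi(G)) = pi.-elt y.
Proof.
move=> yG; apply: mem_normal_Hall yG => //; last exact: pcore_normal.
exact: nilpotent_pcore_Hall (abelian_nil abelG).
Qed.

Lemma Ldiv_sub_pcore q : prime q -> 'Ldiv_q(G) \subset 'O_q(G).
Proof.
move=> q_pr; apply/subsetP => y /LdivP[yG yq]; rewrite mem_abelian_pcore //.
have yd : #[y] %| q by rewrite order_dvdn yq.
exact: pnat_dvd yd (pnat_id q_pr).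
Qed.

Lemma local_nbr_sub_pcore q : prime q -> local_nbr q \subset 'O_q(G).
Proof. by move=> q_pr; rewrite /local_nbr; case: ifP => _; rewrite ?Ldiv_sub_pcore. Qed.

(** The condition splits over primary components: y is decomposed as its
q-part, which local_nbr constrains, times its q'-part, whose order must avoid
all the prime divisors of #[x]. *)
Lemma gcd_order_dvd_prime q : prime q -> q %| #[x] ->
  [set y in G | gcdn #[x] #[y] %| q] = (local_nbr q * 'O_\pi(#[x])^'(G))%g.
Proof.
move=> q_pr qx; apply/setP => y; rewrite inE; apply/andP/mulsgP; last first.
  move=> [a b Aa Bb ->].
  have aO : a \in 'O_q(G) := subsetP (local_nbr_sub_pcore q_pr) _ Aa.
  have aG : a \in G := subsetP (pcore_sub _ _) _ aO.
  have bG : b \in G := subsetP (pcore_sub _ _) _ Bb.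
  have qa : q.-elt a by rewrite -mem_abelian_pcore.
  have bx : coprime #[x] #[b].
    rewrite (@pnat_coprime \pi(#[x])) ?pnat_pi //.
    by move: Bb; rewrite mem_abelian_pcore.
  split; first exact: groupM.
  rewrite orderM; first last.
  - apply: pnat_coprime qa _; apply: sub_in_pnat (_ : \pi(#[x])^'.-nat _); last first.
      by move: Bb; rewrite mem_abelian_pcore.
    move=> s _; apply: contra => /eqP->; by rewrite mem_primes q_pr order_gt0.
  - exact: (centsP abelG).
  rewrite Gauss_gcdl //.
  move: Aa; rewrite /local_nbr; case: ifP => q2x.
    by case/LdivP=> _ aq; apply: dvdn_trans (dvdn_gcdr _ _) _; rewrite order_dvdn aq.
  move=> _.
  (* Here q divides #[x] only once, and the gcd is a power of q. *)
  have [m ma]: {m | #[a] = (q ^ m)%N} by apply: p_natP.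
  have /dvdn_pfactor[//|t _ gt]: gcdn #[x] #[a] %| q ^ m by rewrite -ma dvdn_gcdr.
  rewrite gt; rewrite -[X in _ %| X]expn1 dvdn_exp2l // leqNgt; apply/negP=> t2.
  by case/negP: q2x; apply: dvdn_trans (dvdn_exp2l q t2) _; rewrite -gt dvdn_gcdl.
move=> [yG yd].
exists y.`_q y.`_q^'; last by rewrite consttC.
  rewrite /local_nbr; case: ifP => q2x; last first.
    by rewrite mem_abelian_pcore ?groupX // p_elt_constt.
  apply/LdivP; split; first exact: groupX.
  apply/eqP; rewrite -order_dvdn order_constt p_part.
  rewrite -[X in _ %| X]expn1 dvdn_exp2l // leqNgt; apply/negP=> t2.
  have: q ^ 2 %| q ^ 1.
    apply: dvdn_trans yd; rewrite dvdn_gcd q2x.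
    by rewrite (dvdn_trans _ (pfactor_dvdnn q _)) // dvdn_exp2l.
  by rewrite dvdn_Pexp2l // prime_gt1.
rewrite mem_abelian_pcore ?groupX //; apply/pnatP=> [|s s_pr sy]; first exact: order_gt0.
rewrite !inE /=; apply/negP; rewrite mem_primes => /and3P[_ _ sx].
have /eqP sq : s == q.
  rewrite -dvdn_prime2 //; apply: dvdn_trans yd; rewrite dvdn_gcd sx.
  by apply: dvdn_trans sy _; rewrite order_constt dvdn_part.
have /pnatP := p_elt_constt q^' y; move=> /(_ (order_gt0 _) _ s_pr sy).
by rewrite !inE sq eqxx.
Qed.

Lemma gcd_order_eq1 :
  [set y in G | gcdn #[x] #[y] == 1] = 'O_\pi(#[x])^'(G).
Proof.
apply/setP=> y; rewrite inE; have [yG|yG] /= := boolP (y \in G); last first.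
  by apply/esym/negbTE; apply: contra yG; apply: (subsetP (pcore_sub _ _)).
by rewrite mem_abelian_pcore // /p_elt -coprime_pi' ?order_gt0.
Qed.

Lemma card_local_nbr_pcore q : prime q -> q %| #[x] ->
  #|local_nbr q * 'O_\pi(#[x])^'(G)|%g = #|local_nbr q| * #|'O_\pi(#[x])^'(G)|.
Proof.
move=> q_pr qx; apply: coprime_cardMg.
apply: (@pnat_coprime q).
  exact: pgroupS (local_nbr_sub_pcore q_pr) (pcore_pgroup _ _).
apply: sub_in_pnat (pcore_pgroup _ _) => s _; apply: contra => /eqP->.
by rewrite mem_primes q_pr order_gt0.
Qed.

(** As q is prime, the y whose gcd is q are those whose gcd divides q, a product
of two groups of coprime orders, minus those whose gcd is 1, the second factor
of that product. *)
Lemma card_gcd_order_eq_prime q : prime q -> q %| #[x] ->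
  #|[set y in G | gcdn #[x] #[y] == q]|
    = #|'O_\pi(#[x])^'(G)| * #|local_nbr q|.-1.
Proof.
move=> q_pr qx; rewrite -subn1 mulnBr muln1 [in RHS]mulnC -card_local_nbr_pcore //.
rewrite -gcd_order_dvd_prime // -gcd_order_eq1.
set T := [set y in G | gcdn _ _ %| q]; set U := [set y in G | gcdn _ _ == 1].
have sUT : U \subset T.
  by apply/subsetP=> y; rewrite !inE => /andP[-> /eqP->]; rewrite dvd1n.
rewrite -(setIidPr sUT) -cardsD; apply: eq_card => y; rewrite !inE.
case: (y \in G) => //=; have [_ q_dv] := primeP q_pr.
apply/eqP/andP => [->|[g1 /q_dv /pred2P[g|]//]].
  by rewrite dvdnn neq_ltn prime_gt1 ?orbT.
by rewrite g eqxx in g1.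
Qed.

(** The neighbours are counted by the value of the gcd. The hypothesis on #[x]
means that x itself fails the gcd condition, so that the constraint y != x
costs nothing. *)
Lemma degree_composite_order :
  ~~ ((#[x] == 1) || prime #[x]) ->
  degree (coprime_order_graph G) x
    = #|'O_\pi(#[x])^'(G)| * (\sum_(q <- primes #[x]) #|local_nbr q|.-1).+1.
Proof.
move=> x_npr.
have ->: degree (coprime_order_graph G) x
    = #|[set y in G | gcdn #[x] #[y] \in 1 :: primes #[x]]|.
  apply: eq_card => y; rewrite !inE /coprime_order_graph xG /=.
  case: (y \in G) => //=; rewrite mem_primes order_gt0 dvdn_gcdl !andbT.
  case: eqP => [<-|_] //=; by rewrite gcdnn (negPf x_npr).
rewrite card_fiber_seq; last first.
  by rewrite /= primes_uniq andbT mem_primes.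
rewrite big_cons gcd_order_eq1 mulnS big_distrr /=; congr (_ + _).
rewrite !big_seq; apply: eq_bigr => q.
by rewrite mem_primes => /and3P[q_pr _ qx]; apply: card_gcd_order_eq_prime.
Qed.
End Degree.

(** * Products of cyclic p-groups *)

Lemma card_Ldiv_isog (aT bT : finGroupType) (A : {group aT}) (B : {group bT}) m :
  A \isog B -> #|'Ldiv_m(A)| = #|'Ldiv_m(B)|.
Proof.
case/isogP=> f injf <-; rewrite -(injm_Ldiv injf) card_injm //.
exact: subsetIl.
Qed.

Lemma card_Ldiv_Zp p k : prime p -> 0 < k ->
  #|'Ldiv_p([set: 'Z_(p ^ k)])| = p.
Proof.
move=> p_pr k_gt0; have q_gt1 : 1 < p ^ k by rewrite -(exp1n k) ltn_exp2r ?prime_gt1.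
set G := [set: 'Z_(p ^ k)].
have cG : #|G| = p ^ k by rewrite cardsT card_ord Zp_cast.
have pG : p.-group [set: 'Z_(p ^ k)] by rewrite /pgroup cG pnatX pnat_id.
have cyG : cyclic [set: 'Z_(p ^ k)] by apply/cyclicP; exists Zp1; apply: Zp_cycle.
have := OhmEabelian (n := 1) pG (abelianS (Ohm_sub _ _) (cyclic_abelian cyG)).
rewrite expn1 => <-; apply: Ohm1_cyclic_pgroup_prime => //.
by rewrite trivg_card1 cG neq_ltn q_gt1 orbT.
Qed.

Section ProdCyclic.
Variables (p m : nat) (e : 'I_m -> nat).
Hypotheses (p_pr : prime p) (e_gt0 : forall j, 0 < e j).

Lemma card_prod_cyclic : #|[set: prod_cyclic p e]| = p ^ (\sum_j e j).
Proof.
rewrite cardsT /prod_cyclic card_dep_ffun foldrE big_map big_enum /=.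
rewrite expn_sum; apply: eq_bigr => j _; rewrite card_ord Zp_cast //.
by rewrite -(exp1n (e j)) ltn_exp2r ?prime_gt1.
Qed.

Lemma prod_cyclicX (x : prod_cyclic p e) t j : (x ^+ t) j = (x j ^+ t)%g.
Proof. exact: (morphX (dffun_morphism _ j)). Qed.

Lemma abelian_prod_cyclic : abelian [set: prod_cyclic p e].
Proof.
apply/centsP=> f _ g _; apply/ffunP => j; rewrite !dffunM.
exact: Zp_mulgC.
Qed.

Lemma card_Ldiv_prod_cyclic : #|'Ldiv_p([set: prod_cyclic p e])| = p ^ m.
Proof.
have ->: 'Ldiv_p([set: prod_cyclic p e])
    = setXn (fun j => 'Ldiv_p([set: 'Z_(p ^ e j)])).
  apply/setP=> f; apply/LdivP/setXnP => [[_ fp] j|fp].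
    apply/LdivP; split; first by rewrite inE.
    apply: etrans (esym (prod_cyclicX f p j)) _.
    by rewrite fp ffunE.
  split; rewrite ?inE //; apply/ffunP=> j; apply: etrans (prod_cyclicX f p j) _.
  by rewrite ffunE; have /LdivP[] := fp j.
rewrite cardsXn -[in RHS](card_ord m) -prod_nat_const.
by apply: eq_bigr => j _; apply: card_Ldiv_Zp.
Qed.

End ProdCyclic.

(** * Groups decomposed into primary factors *)

Section DecomposedGroup.
Variables (r : nat) (p : 'I_r -> nat).
Hypotheses (p_prime : forall i, prime (p i)) (p_inj : injective p).
Variables (gT : finGroupType) (G : {group gT}) (Gs : 'I_r -> {group gT}).
Hypothesis defG : (\big[dprod/1]_(i < r) Gs i = G)%g.

(** The centre commutes with direct products. *)
Lemma abelian_bigdprod : (forall i, abelian (Gs i)) -> abelian G.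
Proof.
move=> abGs; apply/center_idP; rewrite -(center_bigdprod defG) -defG.
by apply: eq_bigr => i _; apply/center_idP.
Qed.

Hypothesis pGs : forall i, (p i).-group (Gs i).

Lemma Sylow_bigdprod i : (p i).-Sylow(G) (Gs i).
Proof.
have := defG; rewrite (bigD1 i) //= => defGi.
have [[_ K _ defK] mulG _ _] := dprodP defGi.
rewrite pHallE -{1}mulG defK mulG_subl -(bigdprod_card defG) (bigD1 i) //=.
rewrite partnM ?cardG_gt0 ?prodn_cond_gt0 //.
rewrite (part_pnat_id (pGs i)) part_p'nat ?muln1 //.
elim/big_ind: _ => [//|u v pu pv|j ji]; first by rewrite pnatM pu.
apply: sub_in_pnat (pGs j) => s _ /eqP->.
by rewrite !inE (inj_eq p_inj).
Qed.

Hypothesis abelG : abelian G.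

Lemma pcore_bigdprod i : 'O_(p i)(G) = Gs i.
Proof.
apply: normal_Hall_pcore (Sylow_bigdprod i) _.
by rewrite -sub_abelian_normal ?(pHall_sub (Sylow_bigdprod i)).
Qed.

Lemma Ldiv_bigdprod i : 'Ldiv_(p i)(G) = 'Ldiv_(p i)(Gs i).
Proof.
have sGsG := pHall_sub (Sylow_bigdprod i).
apply/setP=> y; apply/LdivP/LdivP=> -[yG yp]; split=> //; last exact: subsetP yG.
by rewrite -pcore_bigdprod (subsetP (Ldiv_sub_pcore abelG (p_prime i))) //; apply/LdivP.
Qed.

(** The subtraction-free form of the degree formula: the factor |B| of
degree_composite_order is |G| divided by the product on the left. *)
Lemma degree_bigdprod (I : finType) (a : I -> 'I_r) (c : I -> nat) (x : gT) :
    injective a -> (forall i, 0 < c i) -> x \in G ->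
    #[x] = \prod_i p (a i) ^ c i ->
    ~~ ((#[x] == 1) || prime #[x]) ->
  degree (coprime_order_graph G) x * \prod_i #|Gs (a i)|
    = #|G| * (\sum_i #|if 1 < c i then 'Ldiv_(p (a i))(Gs (a i))
                       else Gs (a i)|.-1).+1.
Proof.
move=> a_inj c_gt0 xG ox ncx.
have pa_pr i : prime (p (a i)) by [].
have pa_inj : injective (p \o a) by apply: inj_comp.
have primes_x : perm_eq (primes #[x]) (map (p \o a) (enum I)).
  by rewrite ox; apply: perm_primes_prod_prime_powers.
rewrite (degree_composite_order xG abelG ncx) mulnAC; congr (_ * _.+1).
  rewrite (card_Hall (nilpotent_pcore_Hall _ (abelian_nil abelG))) mulnC.
  rewrite -[in RHS](partnC \pi(#[x]) (cardG_gt0 G)); congr (_ * _).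
  rewrite partn_primes_prod // (perm_big _ primes_x) big_map big_enum.
  by apply: eq_bigr => i _; apply: card_Hall (Sylow_bigdprod _).
rewrite (perm_big _ primes_x) big_map big_enum; apply: eq_bigr => i _ /=.
rewrite /local_nbr Ldiv_bigdprod pcore_bigdprod.
by rewrite pfactor_dvdn // ox (logn_prod_prime_powers c (q := p \o a)) //; case: ifP.
Qed.

End DecomposedGroup.

(** * The degree formulas *)

Definition sum_case (A B C : Type) (f : A -> C) (g : B -> C) (s : A + B) : C :=
  match s with inl i => f i | inr j => g j end.

(** Used to merge the two families of primes, those occurring once and those
occurring at least twice, into one injective family. *)
Lemma inj_sum_case (A B : finType) (C : eqType) (f : A -> C) (g : B -> C) :
  uniq ([seq f i | i : A] ++ [seq g j | j : B]) -> injective (sum_case f g).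
Proof.
rewrite cat_uniq => /and3P[/injectiveP f_inj /hasPn fg /injectiveP g_inj].
have fNg i j : f i <> g j.
  by move=> fgij; have := fg _ (codom_f g j); rewrite -fgij /= codom_f.
by move=> [i|j] [i'|j'] //= => [/f_inj->|/fNg|/esym/fNg|/g_inj->].
Qed.

Import GRing.Theory.
Local Open Scope ring_scope.

Theorem theorem1 (r : nat) (p : 'I_r -> nat)
    (p_prime : forall i, prime (p i)) (p_inj : injective p)
    (n : 'I_r -> nat) (n_gt0 : forall i, (1 <= n i)%N)
    (e : forall i : 'I_r, 'I_(n i) -> nat)
    (e_gt0 : forall (i : 'I_r) (j : 'I_(n i)), (0 < e i j)%N)
    (gT : finGroupType) (G : {group gT}) (Gs : 'I_r -> {group gT})
    (defG : (\big[dprod/1]_(i < r) Gs i = G)%g)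
    (defGs : forall i, Gs i \isog [set: prod_cyclic (p i) (e i)])
    (x : gT) (xG : x \in G) :
  ((#[x]%g = 1%N \/ (exists i, #[x]%g = p i)) ->
     (degree (coprime_order_graph G) x)%:R
       = (\prod_(k < r) p k ^ (\sum_(j < n k) e k j))%N%:R - 1 :> rat)
  /\
  (forall (k l : nat) (alpha : 'I_k -> 'I_r) (beta : 'I_l -> 'I_r)
      (gamma : 'I_l -> nat),
     uniq ([seq p (alpha i) | i : 'I_k] ++ [seq p (beta i) | i : 'I_l]) ->
     (forall i, (2 <= gamma i)%N) ->
     (2 <= k + l <= r)%N \/ (1 <= l)%N ->
     #[x]%g = ((\prod_(i < k) p (alpha i))
               * (\prod_(i < l) p (beta i) ^ gamma i))%N ->
     (degree (coprime_order_graph G) x)%:R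
       = (- k%:R - l%:R + 1 + \sum_(j < k) #|Gs (alpha j)|%:R
          + \sum_(j < l) (p (beta j))%:R ^+ n (beta j))
         * (#|G|%:R / ((\prod_(i < k) #|Gs (alpha i)|%:R)
                       * (\prod_(i < l) #|Gs (beta i)|%:R))) :> rat).
Proof.
have pGs i : ((p i).-group (Gs i))%g.
  by rewrite /pgroup (card_isog (defGs i)) card_prod_cyclic // pnatX pnat_id.
have abelG : abelian G.
  by apply: (abelian_bigdprod defG) => i; rewrite (isog_abelian (defGs i)) abelian_prod_cyclic.
split=> [ox|k l alpha beta gamma uniq_ab gamma_gt1 kl ox].
  rewrite degree_order1_or_prime //; last first.
    by case: ox => [->|[i ->]]; rewrite ?p_prime ?orbT.
  rewrite -subn1 natrB ?cardG_gt0 // -(bigdprod_card defG); congr (_%:R - _).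
  by apply: eq_bigr => i _; rewrite (card_isog (defGs i)) card_prod_cyclic.
pose a := sum_case alpha beta; pose c := sum_case (fun _ : 'I_k => 1%N) gamma.
have c_gt0 s : (0 < c s)%N by case: s => //= j; apply: ltnW.
have pa_inj : injective (p \o a).
  by move=> s t st; apply: (inj_sum_case uniq_ab); case: s t st => [i|j] [i'|j'].
have pa_pr s : prime ((p \o a) s) by apply: p_prime.
have {}ox : #[x]%g = (\prod_s p (a s) ^ c s)%N.
  by rewrite ox big_sumType /=; congr (_ * _)%N; apply: eq_bigr => i _; rewrite expn1.
(* An exponent at least 2, or two distinct prime factors, rule out #[x] = 1 and
   #[x] prime. *)
have ncx : ~~ ((#[x]%g == 1%N) || prime #[x]%g).
  rewrite ox; apply/negP=> ox_pr.
  have l0 (j : 'I_l) : False.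
    have := logn_le1_of_prime_or1 (p (beta j)) ox_pr.
    rewrite (logn_prod_prime_powers c (q := p \o a) pa_pr pa_inj (inr j)) //=.
    by rewrite leqNgt gamma_gt1.
  case: kl => [/andP[kl_gt1 _]|l_gt0]; last exact: (l0 (Ordinal l_gt0)).
  have := size_primes_le1_of_prime_or1 ox_pr.
  rewrite (perm_size (perm_primes_prod_prime_powers (q := p \o a) pa_pr pa_inj c_gt0)).
  by rewrite size_map -cardE card_sum !card_ord leqNgt kl_gt1.
have := degree_bigdprod p_prime p_inj defG pGs abelG (inj_compr pa_inj) c_gt0 xG ox ncx.
move/(congr1 (fun m => m%:R : rat)).
rewrite !big_sumType /= !natrM -natr1 natrD !natr_sum !natr_prod.
have predK (A : {set gT}) : (0 < #|A|)%N -> #|A|.-1%:R = #|A|%:R - 1 :> rat.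
  by move=> A_gt0; rewrite -subn1 natrB.
under [\sum_(i < k) _]eq_bigr => i _ do rewrite predK ?cardG_gt0 //.
under [\sum_(i < l) _]eq_bigr => j _ do
  rewrite gamma_gt1 (card_Ldiv_isog _ (defGs _)) card_Ldiv_prod_cyclic //
    -subn1 natrB ?expn_gt0 ?prime_gt0 // natrX.
rewrite !sumrB !sumr_const !card_ord => deg_eq.
set P := ((\prod_(i < k) _) * (\prod_(i < l) _)) in deg_eq *.
have P_neq0 : P != 0.
  by rewrite mulf_neq0 //; apply/prodf_neq0 => i _; rewrite Num.Theory.pnatr_eq0 -lt0n cardG_gt0.
apply: (mulIf P_neq0); rewrite deg_eq -[RHS]mulrA divfK // [RHS]mulrC.
congr (_ * _); ring.
Qed.
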